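(* Suppose that each $U_i$ is concave and S.S.D. preserving, and that for every $i\in\mathcal N$ and every $Z\in\mathcal X$ the function $c\mapsto U_i(Z+c)$ on $\mathbb R$ is continuous, strictly increasing, and satisfies $\lim_{c\to\infty}U_i(Z+c)=\infty$. Then $\mathcal{PO}\neq\varnothing$ if and only if $\mathcal{CPO}\neq\varnothing$. Moreover, when Pareto optima and comonotone Pareto optima exist, for all $\lambda\in\Lambda$, $$\sup_{(Y_i)\in\mathcal{IR}}\sum_{i=1}^n\lambda_iU_i(Y_i)=\sup_{(Y_i)\in\mathcal{IR}\cap\mathcal A_C}\sum_{i=1}^n\lambda_iU_i(Y_i).$$
   Context: Let $(\Omega,\mathcal F,\mathbb P)$ be an atomless probability space and $\mathcal X:=L^\infty(\Omega,\mathcal F,\mathbb P)$. There are $n\in\mathbb N$ agents indexed by $\mathcal N=\{1,\dots,n\}$ (with $n\ge 2$), agent $i$ having initial endowment $X_i\in\mathcal X$; the aggregate endowment is $S:=\sum_{i=1}^n X_i$. The set of allocations is $\mathcal A:=\{(Y_1,\dots,Y_n)\in\mathcal X^n:\sum_{i=1}^nY_i=S\}$. Each agent $i$ has a utility functional $U_i:\mathcal X\to\mathbb R$. An allocation is individually rational (IR) if $U_i(Y_i)\ge U_i(X_i)$ for all $i$; $\mathcal{IR}$ is the set of IR allocations. An allocation $(Y_i^* )\in\mathcal A$ is Pareto optimal (PO) if it is IR and there is no other IR allocation $(Y_i)$ with $U_i(Y_i)\ge U_i(Y_i^* )$ for all $i$ and at least one strict inequality; $\mathcal{PO}$ is the set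 of PO allocations. A random vector $(Z_1,\dots,Z_n)$ is comonotone if $(Z_i(\omega_1)-Z_i(\omega_2))(Z_j(\omega_1)-Z_j(\omega_2))\ge0$ for all $\omega_1,\omega_2$, $i,j$. $\mathcal A_C$ is the set of comonotone allocations. An allocation $(Y_i^* )\in\mathcal A_C$ is comonotone Pareto optimal (CPO) if it is IR and there is no other IR allocation in $\mathcal A_C$ weakly improving all agents and strictly improving one; $\mathcal{CPO}$ is the set of CPO allocations. $\Lambda:=\mathbb R_+^n\setminus\{0\}$. For $Z_1,Z_2\in\mathcal X$, $Z_1\preccurlyeq_{ICV}Z_2$ (increasing concave order / second-order stochastic dominance) means $\mathbb E[\phi(Z_1)]\le\mathbb E[\phi(Z_2)]$ for every non-decreasing concave $\phi:\mathbb R\to\mathbb R$. A functional $U$ is S.S.D. preserving if $Z_1\preccurlyeq_{ICV}Z_2$ implies $U(Z_1)\le U(Z_2)$. *)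

(* Defs.v *)
From HB Require Import structures.
From mathcomp Require Import all_boot all_order all_algebra.
From mathcomp Require Import all_classical all_reals all_analysis.
Set Implicit Arguments. Unset Strict Implicit. Unset Printing Implicit Defensive.
Import Order.TTheory GRing.Theory Num.Theory.
Import numFieldNormedType.Exports.
Local Open Scope classical_set_scope.
Local Open Scope ring_scope.

Section Risk.
Context {d : measure_display} {T : measurableType d} {R : realType}.

Definition atomless (P : probability T R) : Prop :=
  forall A, measurable A -> (0 < P A)%E ->
    exists B, [/\ measurable B, B `<=` A, (0 < P B)%E & (P B < P A)%E].

(* representatives of L^infty: bounded measurable functions *)
Definition Linf (Z : T -> R) : Prop :=
  measurable_fun setT Z /\ exists M : R, forall w, `|Z w| <= M.

Definition icv_le (P : probability T R) (Z1 Z2 : T -> R) : Prop :=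
  forall phi : R -> R,
    {homo phi : x y / x <= y} ->
    (forall x y (t : R), 0 <= t <= 1 ->
        t * phi x + (1 - t) * phi y <= phi (t * x + (1 - t) * y)) ->
    (\int[P]_w (phi (Z1 w))%:E <= \int[P]_w (phi (Z2 w))%:E)%E.

Definition ssd_preserving (P : probability T R) (U : (T -> R) -> R) : Prop :=
  forall Z1 Z2, Linf Z1 -> Linf Z2 -> icv_le P Z1 Z2 -> U Z1 <= U Z2.

Definition concave_util (U : (T -> R) -> R) : Prop :=
  forall Z1 Z2 (t : R), Linf Z1 -> Linf Z2 -> 0 <= t <= 1 ->
    t * U Z1 + (1 - t) * U Z2 <= U (fun w => t * Z1 w + (1 - t) * Z2 w).

Variable n : nat.

Definition aggregate (X : 'I_n -> T -> R) : T -> R := fun w => \sum_(i < n) X i w.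

Definition allocation (X Y : 'I_n -> T -> R) : Prop :=
  (forall i, Linf (Y i)) /\ forall w, \sum_(i < n) Y i w = aggregate X w.

Definition comonotone (Y : 'I_n -> T -> R) : Prop :=
  forall w1 w2 i j, 0 <= (Y i w1 - Y i w2) * (Y j w1 - Y j w2).

Definition indiv_rational (U : 'I_n -> (T -> R) -> R) (X Y : 'I_n -> T -> R) : Prop :=
  allocation X Y /\ forall i, U i (X i) <= U i (Y i).

Definition pareto_opt U X Y : Prop :=
  indiv_rational U X Y /\
  ~ exists Y', indiv_rational U X Y' /\ (forall i, U i (Y i) <= U i (Y' i)) /\
               exists i, U i (Y i) < U i (Y' i).

Definition comonotone_pareto_opt U X Y : Prop :=
  comonotone Y /\ indiv_rational U X Y /\
  ~ exists Y', comonotone Y' /\ indiv_rational U X Y' /\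
               (forall i, U i (Y i) <= U i (Y' i)) /\
               exists i, U i (Y i) < U i (Y' i).

Definition weighted_sup U X (lam : 'I_n -> R) (C : ('I_n -> T -> R) -> Prop) : \bar R :=
  ereal_sup [set (\sum_(i < n) lam i * U i (Y i))%:E | Y in
               [set Y | indiv_rational U X Y /\ C Y]].

End Risk.

(* Main.v *)
Require Import Defs.
From HB Require Import structures.
From mathcomp Require Import all_boot all_order all_algebra.
From mathcomp Require Import all_classical all_reals all_analysis.
From mathcomp Require Import measurable_realfun ring lra.
Import Order.TTheory GRing.Theory Num.Theory.
Import numFieldNormedType.Exports.
Local Open Scope classical_set_scope.
Local Open Scope ring_scope.
Set Implicit Arguments. Unset Strict Implicit. Unset Printing Implicit Defensive.

(** Everything follows from comonotone improvement: each bounded allocation is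
  dominated agentwise in the increasing concave order by a comonotone allocation
  of the same total.
  For finitely many states, Pigou-Dalton transfers between two agents and two states
  improve both agents and lower the quadratic energy by a fixed amount as long as
  comonotonicity fails by more than a given tolerance; hence they stop. In general,
  the allocation is rounded to finitely many states, and the resulting almost
  comonotone allocations converge along an ultrafilter, uniformly because each
  share is almost a 1-Lipschitz function of the total. *)

(** * Concavity and transfers between two states *)

Definition nondecreasing_concave {R : realType} (phi : R -> R) : Prop :=
  {homo phi : x y / x <= y} /\
  forall x y (t : R), 0 <= t <= 1 ->
    t * phi x + (1 - t) * phi y <= phi (t * x + (1 - t) * y).

Section FiniteStates.
Context {R : realType} {C : finType} (q : C -> R).

Lemma sum_change2 (g h : C -> R) (c c' : C) : c != c' ->
  (forall e, e != c -> e != c' -> h e = g e) ->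
  \sum_e h e = \sum_e g e + (h c - g c) + (h c' - g c').
Proof.
move=> cc' hg; have c'c : c' != c by rewrite eq_sym.
rewrite (bigD1 c) // (bigD1 c') //= [X in _ = X + _ + _](bigD1 c) //.
rewrite [X in _ = _ + X + _ + _](bigD1 c') //=.
have -> : \sum_(e | (e != c) && (e != c')) h e = \sum_(e | (e != c) && (e != c')) g e.
  by apply: eq_bigr => e /andP[ec ec']; exact: hg.
ring.
Qed.

(** Both new values lie between [b] and [a], where concavity keeps [phi] above its chord; since
    [k * u = k' * v], the chord terms in [phi a - phi b] cancel. *)
Lemma concave_contract (phi : R -> R) (a b u v k k' : R) :
  nondecreasing_concave phi -> b < a -> 0 <= u <= a - b -> 0 <= v <= a - b ->
  k * u = k' * v -> 0 <= k -> 0 <= k' ->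
  k * phi a + k' * phi b <= k * phi (a - u) + k' * phi (b + v).
Proof.
move=> [_ phic] ba /andP[u0 u1] /andP[v0 v1] kk k0 k'0.
have ab0 : 0 < a - b by rewrite subr_gt0.
have abn : a - b != 0 by rewrite gt_eqF.
have unit_ratio w : 0 <= w -> w <= a - b -> 0 <= 1 - w / (a - b) <= 1.
  move=> w0 w1; rewrite subr_ge0 ler_pdivrMr// mul1r w1/= gerBl.
  by rewrite divr_ge0// ltW.
have Ha := phic a b _ (unit_ratio u u0 u1).
have Hb := phic b a _ (unit_ratio v v0 v1).
rewrite (_ : _ * a + _ = a - u) in Ha; last by field.
rewrite (_ : _ * b + _ = b + v) in Hb; last by field.
apply: le_trans (lerD (ler_wpM2l k0 Ha) (ler_wpM2l k'0 Hb)).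
rewrite le_eqVlt; apply/orP; left; apply/eqP.
have -> : k' * ((1 - v / (a - b)) * phi b + (1 - (1 - v / (a - b))) * phi a) =
  k' * phi b + (k' * v) / (a - b) * (phi a - phi b) by field.
by rewrite -kk; field.
Qed.

(** The amount [t] is weighted mass: dividing by [q] in each state keeps the weighted mean when [c]
    and [c'] differ. *)
Definition transfer (z : C -> R) (c c' : C) (t : R) : C -> R := fun e =>
  z e + (if e == c then - (t / q c) else if e == c' then t / q c' else 0).

Section Transfer.
Variables (z : C -> R) (c c' : C) (g t : R).
Hypotheses (q_gt0 : forall e, 0 < q e) (g_gt0 : 0 < g) (t_ge0 : 0 <= t).
Hypotheses (gap : z c' + g <= z c).
Hypotheses (tc : t / q c <= g / 2) (tc' : t / q c' <= g / 2).

Let gap_neq : c != c'.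
Proof. by apply/eqP => cc; move: gap g_gt0; rewrite cc; lra. Qed.

Let transfer_c : transfer z c c' t c = z c - t / q c.
Proof. by rewrite /transfer eqxx. Qed.

Let transfer_c' : transfer z c c' t c' = z c' + t / q c'.
Proof. by rewrite /transfer eq_sym (negbTE gap_neq) eqxx. Qed.

Let transfer_other e : e != c -> e != c' -> transfer z c c' t e = z e.
Proof. by move=> /negbTE ec /negbTE ec'; rewrite /transfer ec ec' addr0. Qed.

Let tq_ge0 e : 0 <= t / q e.
Proof. by rewrite divr_ge0// ltW. Qed.

Let qtq e : q e * (t / q e) = t.
Proof. by rewrite mulrCA divff ?mulr1// gt_eqF. Qed.

(** Each of the two values moves by at most half of the gap [g], so they approach without
    crossing. *)
Lemma transfer_bound (M : R) : (forall e, `|z e| <= M) ->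
  forall e, `|transfer z c c' t e| <= M.
Proof.
move=> zM e; have [->|ec] := eqVneq e c.
  rewrite transfer_c ler_norml.
  have := zM c; have := zM c'; rewrite !ler_norml.
  have := tq_ge0 c; move: gap tc g_gt0; lra.
have [->|ec'] := eqVneq e c'; last by rewrite transfer_other.
rewrite transfer_c' ler_norml.
have := zM c; have := zM c'; rewrite !ler_norml.
have := tq_ge0 c'; move: gap tc' g_gt0; lra.
Qed.

Lemma transfer_concave (phi : R -> R) : nondecreasing_concave phi ->
  \sum_e q e * phi (z e) <= \sum_e q e * phi (transfer z c c' t e).
Proof.
move=> phic.
rewrite (@sum_change2 (fun e => q e * phi (z e))
  (fun e => q e * phi (transfer z c c' t e)) _ _ gap_neq); last first.
  by move=> e ec ec'; rewrite transfer_other.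
rewrite transfer_c transfer_c'.
have := @concave_contract phi (z c) (z c') (t / q c) (t / q c') (q c) (q c') phic.
have /(_ c)/ltW qc := q_gt0; have /(_ c')/ltW qc' := q_gt0.
rewrite !tq_ge0 !qtq qc qc' /=.
have -> : z c' < z c by move: gap g_gt0; lra.
have -> : t / q c <= z c - z c' by move: gap tc g_gt0; lra.
have -> : t / q c' <= z c - z c' by move: gap tc' g_gt0; lra.
move=> /(_ erefl erefl erefl erefl erefl erefl); lra.
Qed.

(** With shifts [u] and [v] the change is [t * (u + v - 2 * (z c - z c'))], where [u + v <= g] and
    [z c - z c' >= g]. *)
Lemma transfer_energy :
  \sum_e q e * transfer z c c' t e ^+ 2 <= \sum_e q e * z e ^+ 2 - t * g.
Proof.
rewrite (@sum_change2 (fun e => q e * z e ^+ 2)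
  (fun e => q e * transfer z c c' t e ^+ 2) _ _ gap_neq); last first.
  by move=> e ec ec'; rewrite transfer_other.
rewrite transfer_c transfer_c'.
set u := t / q c; set v := t / q c'.
have -> : q c * (z c - u) ^+ 2 - q c * z c ^+ 2 = (q c * u) * (u - 2 * z c) by ring.
have -> : q c' * (z c' + v) ^+ 2 - q c' * z c' ^+ 2 = (q c' * v) * (v + 2 * z c') by ring.
rewrite !qtq -addrA lerD2l -mulrDr -[X in _ <= X]mulrN ler_wpM2l//.
by move: gap tc tc'; rewrite -/u -/v; lra.
Qed.

End Transfer.

(** * Energy descent for allocations on finitely many states *)

Section Allocation.
Context {n : nat}.
Variables (delta eta M : R).
Hypotheses (delta_gt0 : 0 < delta) (eta_gt0 : 0 < eta).
Hypothesis q_ge : forall c, delta <= q c.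

Let energy (y : 'I_n -> C -> R) := \sum_i \sum_c q c * y i c ^+ 2.
Let g : R := eta / n%:R.

Definition finite_dominates (y0 y : 'I_n -> C -> R) : Prop :=
  [/\ forall i c, `|y i c| <= M,
      forall c, \sum_i y i c = \sum_i y0 i c &
      forall i (phi : R -> R), nondecreasing_concave phi ->
        \sum_c q c * phi (y0 i c) <= \sum_c q c * phi (y i c)].

(* If agent i holds more in c than in c' by eta although the total is not larger
   in c, some agent j holds more in c' than in c by eta / n; shifting a little of
   these surpluses in opposite directions is better for both and lowers the energy
   by a fixed amount. *)
Lemma finite_step (y : 'I_n -> C -> R) i c c' :
  (forall i c, `|y i c| <= M) ->
  \sum_k y k c <= \sum_k y k c' -> y i c' + eta < y i c ->
  exists2 y', finite_dominates y y' & energy y' <= energy y - delta * g ^+ 2.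
Proof.
move=> yM sumcc' viol.
have n_gt0 : (0 < n)%N by exact: leq_ltn_trans (leq0n i) (ltn_ord i).
have nR_gt0 : 0 < n%:R :> R by rewrite ltr0n.
have g_gt0 : 0 < g by rewrite divr_gt0.
have q_gt0 e : 0 < q e by exact: lt_le_trans (q_ge e).
(* Otherwise agent [i] loses more than [eta] from [c] to [c'] while the others gain at most
   [(n - 1) * g = eta - g] together, so the total would drop. *)
have [j gapj] : exists j, y j c + g <= y j c'.
  apply: contrapT => /forallNP noj.
  have : \sum_k (y k c' - y k c) < 0.
    rewrite (bigD1 i)//=.
    have : \sum_(k | k != i) (y k c' - y k c) <= \sum_(k | k != i) g.
      by apply: ler_sum => k _; have /negP := noj k; rewrite -ltNge; lra.
    have : \sum_(k < n) g = eta.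
      by rewrite sumr_const card_ord -mulr_natr divfK// gt_eqF.
    rewrite (bigD1 i)//=; move: viol; lra.
  by rewrite sumrB; move: sumcc'; lra.
have ij : i != j by apply/eqP => ij; move: viol gapj eta_gt0 g_gt0; rewrite ij; lra.
have gapi : y i c' + g <= y i c.
  apply: le_trans (ltW viol); rewrite lerD2l ler_pdivrMr// ler_peMr//.
    exact: ltW.
  by rewrite ler1n.
(* Since [q e >= delta], this amount shifts no value by more than [g / 2]; the two agents together
   lose energy [2 * t * g = delta * g ^+ 2]. *)
pose t := delta * g / 2.
have t_ge0 : 0 <= t by rewrite /t; have := mulr_gt0 delta_gt0 g_gt0; lra.
have tq e : t / q e <= g / 2.
  rewrite ler_pdivrMr// /t; have := ler_wpM2r (ltW g_gt0) (q_ge e); lra.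
pose y' k := if k == i then transfer (y i) c c' t
             else if k == j then transfer (y j) c' c t else y k.
have y'i : y' i = transfer (y i) c c' t by rewrite /y' eqxx.
have y'j : y' j = transfer (y j) c' c t by rewrite /y' eq_sym (negbTE ij) eqxx.
have y'k k : k != i -> k != j -> y' k = y k.
  by move=> /negbTE ki /negbTE kj; rewrite /y' ki kj.
exists y'.
  split=> [k e|e|k phi phic].
  - have [->|ki] := eqVneq k i; first by rewrite y'i; exact: (@transfer_bound _ _ _ g).
    have [->|kj] := eqVneq k j; first by rewrite y'j; exact: (@transfer_bound _ _ _ g).
    by rewrite y'k.
  - rewrite (bigD1 i)// (bigD1 j) 1?eq_sym//= [RHS](bigD1 i)// [X in _ = _ + X](bigD1 j) 1?eq_sym//=.
    rewrite y'i y'j /transfer.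
    rewrite (eq_bigr (fun k => y k e)); last by move=> k /andP[ki kj]; rewrite y'k.
    have cc' : c != c' by apply/eqP => cc; move: viol eta_gt0; rewrite cc; lra.
    have [->|ec] := eqVneq e c; first by rewrite (negbTE cc'); ring.
    by case: ifP => _; ring.
  - have [->|ki] := eqVneq k i; first by rewrite y'i; exact: (@transfer_concave _ _ _ g).
    have [->|kj] := eqVneq k j; first by rewrite y'j; exact: (@transfer_concave _ _ _ g).
    by rewrite y'k.
rewrite /energy (bigD1 i)// (bigD1 j) 1?eq_sym//= [X in _ <= X - _](bigD1 i)//.
rewrite [X in _ <= _ + X - _](bigD1 j) 1?eq_sym//=.
rewrite [X in _ + (_ + X) <= _](eq_bigr (fun k => \sum_c q c * y k c ^+ 2)); last first.
  by move=> k /andP[ki kj]; rewrite y'k.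
rewrite y'i y'j.
have := @transfer_energy (y i) c c' g t q_gt0 g_gt0 t_ge0 gapi (tq c) (tq c').
have := @transfer_energy (y j) c' c g t q_gt0 g_gt0 t_ge0 gapj (tq c') (tq c).
have -> : t * g = delta * g ^+ 2 / 2 by rewrite /t; ring.
lra.
Qed.

(** While some violation exceeds [eta], a further step exists; without an end, the fixed losses
    would push the nonnegative energy below zero. *)
Lemma finite_improvement (y0 : 'I_n -> C -> R) :
  (forall i c, `|y0 i c| <= M) ->
  exists2 y, finite_dominates y0 y &
    forall i c c', \sum_k y0 k c <= \sum_k y0 k c' -> y i c <= y i c' + eta.
Proof.
move=> y0M; apply: contrapT => none.
have descent (m : nat) : exists2 y, finite_dominates y0 y &
    energy y <= energy y0 - m%:R * (delta * g ^+ 2).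
  elim: m => [|m [y [yM ysum yphi] yE]].
    by exists y0; [split|rewrite mul0r subr0].
  have [i [c [c' [sumcc' viol]]]] : exists i c c',
      \sum_k y k c <= \sum_k y k c' /\ y i c' + eta < y i c.
    apply: contrapT => ok; apply: none; exists y => // i c c'.
    rewrite -!ysum => sumcc'; rewrite leNgt; apply/negP => viol.
    by apply: ok; exists i, c, c'.
  have [y' [y'M y'sum y'phi] y'E] := @finite_step y i c c' yM sumcc' viol.
  exists y'.
    split=> // [e|k phi phic]; first by rewrite y'sum.
    exact: le_trans (yphi _ _ phic) (y'phi _ _ phic).
  by rewrite -natr1 mulrDl mul1r; lra.
(* For [n = 0] the quotient [eta / n] is zero, so the loss per step is not positive; the claim about
   agents is then empty. *)
have [n0|n_gt0] := posnP n.
  by apply: none; exists y0 => // i; have := ltn_ord i; rewrite [X in (_ < X)%N]n0.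
have k_gt0 : 0 < delta * g ^+ 2 by rewrite mulr_gt0// exprn_gt0// divr_gt0// ltr0n.
have [y _] := descent (Num.truncn (energy y0 / (delta * g ^+ 2))).+1.
apply/negP; rewrite -ltNge.
have Ey_ge0 : 0 <= energy y.
  apply: sumr_ge0 => i _; apply: sumr_ge0 => c _.
  by rewrite mulr_ge0 ?sqr_ge0// (le_trans (ltW delta_gt0)).
apply: lt_le_trans Ey_ge0; rewrite subr_lt0 -ltr_pdivrMr//.
exact: truncnS_gt.
Qed.

End Allocation.
End FiniteStates.

(** * Tools for bounded functions: Lipschitz bounds, integrals, discretization *)

Lemma concave_lipschitz {R : realType} (phi : R -> R) (M : R) :
  nondecreasing_concave phi ->
  exists2 L, 0 <= L & forall x y, `|x| <= M -> `|y| <= M ->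
    phi y <= phi x + L * `|y - x|.
Proof.
move=> [phi_homo phic]; exists (phi (- M) - phi (- M - 1)).
  by rewrite subr_ge0 phi_homo// gerBl.
(* [L] is the slope on the unit interval from [a] to [- M], left of the range; slopes of a concave
   function decrease. *)
set L := _ - _; set a := - M - 1 => x y; rewrite !ler_norml => /andP[Mx xM] /andP[My yM].
have L_ge0 : 0 <= L by rewrite subr_ge0 phi_homo// gerBl.
have [yx|xy] := leP y x.
  by rewrite (le_trans (phi_homo _ _ yx))// lerDl mulr_ge0.
have ya_gt0 : 0 < y - a by rewrite /a; lra.
have ya_neq0 : y - a != 0 by rewrite gt_eqF.
have slope : phi y - phi a <= L * (y - a).
  have s01 : 0 <= 1 - (y - a)^-1 <= 1.
    by rewrite subr_ge0 invf_le1// gerBl invr_ge0 (ltW ya_gt0) andbT /a; lra.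
  have := phic a y _ s01.
  have -> : (1 - (y - a)^-1) * a + (1 - (1 - (y - a)^-1)) * y = - M.
    have -> : - M = a + 1 by rewrite /a; ring.
    by field.
  have -> : (1 - (y - a)^-1) * phi a + (1 - (1 - (y - a)^-1)) * phi y =
    phi a + (phi y - phi a) / (y - a) by ring.
  by rewrite -ler_pdivrMr// /L; lra.
(* [x] divides the segment from [a] to [y], so [phi y - phi x] is at most [t * (phi y - phi a)]. *)
pose t := (y - x) / (y - a).
have t01 : 0 <= t <= 1.
  by rewrite /t divr_ge0 ?ler_pdivrMr// /a; lra.
have := phic a y _ t01.
have -> : t * a + (1 - t) * y = x by rewrite /t; field.
have /andP[t0 _] := t01; have := ler_wpM2l t0 slope.
have -> : t * (L * (y - a)) = L * (y - x) by rewrite /t; field.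
by rewrite gtr0_norm ?subr_gt0//; lra.
Qed.

Section BoundedFunctions.
Context {d : measure_display} {T : measurableType d} {R : realType}.
Variable P : probability T R.

Lemma Linf_integrable (f : T -> R) : Linf f -> P.-integrable setT (EFin \o f).
Proof.
move=> [mf [M fM]]; apply: measurable_bounded_integrable => //.
  by rewrite (le_lt_trans (probability_le1 P measurableT))// ltry.
exists M; split; first exact: num_real.
by move=> x Mx w _ /=; exact: le_trans (fM w) (ltW Mx).
Qed.

Lemma Linf_cst (c : R) : Linf (fun _ : T => c).
Proof. by split; [exact: measurable_cst|exists `|c|]. Qed.

Lemma LinfD (f g : T -> R) : Linf f -> Linf g -> Linf (fun w => f w + g w).
Proof.
move=> [mf [M fM]] [mg [N gN]]; split; first exact: measurable_funD.
by exists (M + N) => w; apply: le_trans (ler_normD _ _) (lerD (fM w) (gN w)).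
Qed.

Lemma Linf_sum (I : Type) (s : seq I) (h : I -> T -> R) :
  (forall i, Linf (h i)) -> Linf (fun w => \sum_(i <- s) h i w).
Proof.
move=> hL; elim: s => [|i s IH].
  rewrite (_ : (fun _ => _) = fun=> 0); first exact: Linf_cst.
  by apply/funext => w; rewrite big_nil.
rewrite (_ : (fun _ => _) = fun w => h i w + \sum_(j <- s) h j w).
  exact: LinfD.
by apply/funext => w; rewrite big_cons.
Qed.

Lemma Linf_indicZ (A : set T) (r : R) : measurable A ->
  Linf (fun w => r * \1_A w : R).
Proof.
move=> mA; split.
  by apply: measurable_funM; [exact: measurable_cst|exact: measurable_indic].
exists `|r| => w; rewrite normrM indicE.
by case: (w \in A); rewrite ?normr1 ?normr0 ?mulr1 ?mulr0.
Qed.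

Lemma Linf_monotone_bound (f : T -> R) (phi : R -> R) : {homo phi : x y / x <= y} ->
  Linf f -> Linf (fun w => phi (f w)).
Proof.
move=> phi_homo [mf [M fM]]; split.
  apply: measurableT_comp mf; exact: nondecreasing_measurable.
exists (`|phi M| + `|phi (- M)|) => w; have := fM w; rewrite !ler_norml => /andP[Mf fM'].
have := phi_homo _ _ Mf; have := phi_homo _ _ fM'.
have := ler_norm (phi M); have := ler_norm (- phi (- M)); rewrite normrN.
have := normr_ge0 (phi M); have := normr_ge0 (phi (- M)).
by move=> *; apply/andP; split; lra.
Qed.

Lemma Rintegral_le_add (f g : T -> R) (e : R) : Linf f -> Linf g ->
  (forall w, f w <= g w + e) -> \int[P]_w f w <= \int[P]_w g w + e.
Proof.
move=> fL gL fg.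
have -> : e = \int[P]_(_ in setT) e.
  by rewrite Rintegral_cst//= probability_setT mulr1.
have fP := Linf_integrable fL; have gP := Linf_integrable gL.
have eP := Linf_integrable (Linf_cst e).
rewrite -RintegralD//; apply: le_Rintegral => //.
exact: Linf_integrable (LinfD gL (Linf_cst e)).
Qed.

Lemma Rintegral_sum (I : Type) (s : seq I) (h : I -> T -> R) :
  (forall i, Linf (h i)) ->
  \int[P]_w (\sum_(i <- s) h i w) = \sum_(i <- s) \int[P]_w h i w.
Proof.
move=> hL; elim: s => [|i s IH].
  rewrite big_nil; transitivity (\int[P]_(w in setT) (0 : R)).
    by apply: eq_Rintegral => w _; rewrite big_nil.
  by rewrite Rintegral_cst// mul0r.
have hiP := Linf_integrable (hL i); have hsP := Linf_integrable (Linf_sum s hL).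
rewrite big_cons -IH -RintegralD//.
by apply: eq_Rintegral => w _; rewrite big_cons.
Qed.

Section Cells.
Context {C : finType} (cell : T -> C).
Hypothesis mcell : forall c, measurable (cell @^-1` [set c]).

Let cell_sum (f : C -> R) : (fun w => f (cell w)) =
  fun w => \sum_c f c * \1_(cell @^-1` [set c]) w.
Proof.
apply/funext => w; rewrite (bigD1 (cell w))//= indicE mem_set// mulr1.
rewrite big1 ?addr0// => c /eqP cw; rewrite indicE memNset ?mulr0// => /= wc.
exact/cw.
Qed.

Lemma Linf_cell (f : C -> R) : Linf (fun w => f (cell w)).
Proof. by rewrite cell_sum; apply: Linf_sum => c; exact: Linf_indicZ. Qed.

Lemma Rintegral_cell (f : C -> R) :
  \int[P]_w f (cell w) = \sum_c fine (P (cell @^-1` [set c])) * f c.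
Proof.
have -> : \int[P]_w f (cell w) = \int[P]_w \sum_c f c * \1_(cell @^-1` [set c]) w.
  by rewrite -cell_sum.
rewrite Rintegral_sum; last by move=> c; exact: Linf_indicZ.
apply: eq_bigr => c _; rewrite RintegralZl//; last exact: integrable_indic.
by rewrite mulrC /Rintegral integral_indic// setIT.
Qed.

End Cells.

(** Each share is rounded down to a grid of mesh [e] starting at [- M]; a cell is the vector of all
    grid indices. *)
Lemma discretize (n : nat) (Y : 'I_n -> T -> R) (M e : R) :
  (forall i, measurable_fun setT (Y i)) -> (forall i w, `|Y i w| <= M) ->
  0 <= M -> 0 < e ->
  exists (C : finType) (cell : T -> C) (y : 'I_n -> C -> R),
    [/\ forall c, measurable (cell @^-1` [set c]),
        forall i c, `|y i c| <= M &
        forall i w, `|Y i w - y i (cell w)| <= e].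
Proof.
(* Shares range over an interval of length [2 * M], so every index is at most [N] and [inord] never
   returns its default. *)
move=> mY YM M_ge0 e_gt0; pose N := Num.truncn (2 * M / e).
pose k (x : R) := Num.truncn ((x + M) / e).
pose idx (i : 'I_n) (w : T) : 'I_N.+1 := inord (k (Y i w)).
have YM0 i w : 0 <= (Y i w + M) / e.
  by rewrite divr_ge0 ?(ltW e_gt0)//; have := YM i w; rewrite ler_norml; lra.
have idxE i w : idx i w = k (Y i w) :> nat.
  rewrite inordK// ltnS le_truncn// ler_pM2r ?invr_gt0//.
  by have := YM i w; rewrite ler_norml; lra.
exists {ffun 'I_n -> 'I_N.+1}, (fun w => [ffun i => idx i w]).
exists (fun i (c : {ffun 'I_n -> 'I_N.+1}) => Num.min (- M + e * (c i)%:R) M); split.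
- move=> c.
  have -> : (fun w => [ffun i => idx i w]) @^-1` [set c] =
      \bigcap_(i in [set: 'I_n]) (Y i @^-1` (k @^-1` [set nat_of_ord (c i)])
        `&` Y i @^-1` [set x | 0 <= (x + M) / e]).
    apply/seteqP; split => w /=.
      by move=> <- i _; rewrite /= ffunE idxE.
    move=> H; apply/ffunP => i; rewrite ffunE; apply/val_inj => /=.
    by have /= [<- _] := H i I; exact: idxE.
  apply: fin_bigcap_measurable => [|i _]; first exact: finite_finset.
  apply: measurableI.
    rewrite -[X in measurable X]setTI; apply: mY => //.
    (* Since [k] is nondecreasing, its level sets are intervals. *)
    apply: is_interval_measurable => x y /= kx ky z /andP[xz zy].
    apply/eqP; rewrite eqn_leq -{1}ky -kx; apply/andP.
    by split; apply: le_truncn; rewrite ler_pM2r ?invr_gt0// lerD2r.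
  rewrite -[X in measurable X]setTI; apply: mY => //.
  apply: is_interval_measurable => x y /= kx ky z /andP[xz zy].
  by apply: le_trans kx _; rewrite ler_pM2r ?invr_gt0// lerD2r.
- move=> i c; rewrite ler_norml le_min ge_min lexx orbT andbT.
  by rewrite lerDl mulr_ge0 ?(ltW e_gt0)//= ge0_cp.
- move=> i w; rewrite ffunE idxE.
  have /andP[] := truncn_itv (YM0 i w); rewrite -/(k (Y i w)).
  rewrite ler_pdivlMr// ltr_pdivrMr// -natr1 mulrDl mul1r mulrC => lo hi.
  have := YM i w; rewrite !ler_norml => /andP[_ YM1].
  by rewrite /Num.min; case: ifP => [|/negbT]; rewrite -?leNgt; lra.
Qed.
End BoundedFunctions.

(** * Limits along an ultrafilter and control of errors *)

Lemma ultra_bounded_limit {R : realType} (F : set_system nat) (u : nat -> R) (M : R) :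
  UltraFilter F -> (forall m, `|u m| <= M) ->
  exists l, forall e, 0 < e -> F [set m | `|u m - l| <= e].
Proof.
move=> FU uM; have FP : ProperFilter F by exact: (@ultra_proper _ F FU).
(* Compactness gives a cluster point, and an ultrafilter converges to its cluster points because it
   contains each set or its complement. *)
have [|l [_ Fl]] := @segment_compact R (- M) M (u @ F) _.
  by rewrite nbhs_filterE; apply: (@filterE _ F) => m /=; rewrite in_itv/= -ler_norml.
exists l => e e_gt0.
have [//|FC] := in_ultra_setVsetC [set m | `|u m - l| <= e] FU.
have [] := Fl (u @` ~` [set m | `|u m - l| <= e]) (ball l e).
- by apply: (@filterS _ F _ _ _ _ FC) => m um; exists m.
- exact: nbhsx_ballx.
by move=> _ [[m /= um <-]]; rewrite -ball_normE/= distrC => /ltW.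
Qed.

Lemma le_of_forall_eps {R : realType} (x y k : R) :
  (forall e, 0 < e -> x <= y + k * e) -> x <= y.
Proof.
move=> H; apply/ler_addgt0Pr => e e_gt0.
have k_gt0 : 0 < `|k| + 1 by rewrite ltr_wpDl.
apply: le_trans (H (e / (`|k| + 1)) _) _; first by rewrite divr_gt0.
rewrite lerD2l mulrA ler_pdivrMr// mulrC ler_pM2l//.
by rewrite (le_trans (ler_norm k))// lerDl.
Qed.

(* The increments of almost comonotone functions almost have one sign, so each of
   them is controlled by the increment of the sum. *)
Lemma almost_comonotone_lipschitz {R : realType} (n : nat) (a b : 'I_n -> R)
    (s t e : R) : 0 <= e ->
  `|\sum_i a i - s| <= n%:R * e -> `|\sum_i b i - t| <= n%:R * e ->
  (forall i, a i <= b i + e) \/ (forall i, b i <= a i + e) ->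
  forall i, `|a i - b i| <= `|s - t| + 3 * n%:R * e.
Proof.
wlog ab : a b s t / forall i, a i <= b i + e.
  move=> H e0 Ha Hb [] ab i; first by apply: (H _ _ _ _ ab) => //; left.
  by rewrite distrC (distrC s); apply: (H _ _ _ _ ab) => //; left.
move=> e_ge0 Ha Hb _ i.
have n_ge1 : 1 <= n%:R :> R by rewrite ler1n (leq_ltn_trans (leq0n i)).
(* The other increments are at least [- e]. This costs one [n * e]; the errors in the two sums cost
   the other two. *)
have sum_le : b i - a i <= \sum_k (b k - a k) + n%:R * e.
  rewrite (bigD1 i)//=.
  have : \sum_(k | k != i) (- e) <= \sum_(k | k != i) (b k - a k).
    by apply: ler_sum => k _; have := ab k; lra.
  have : \sum_(k < n) (- e) = - (n%:R * e).
    by rewrite sumr_const card_ord mulNrn mulr_natl.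
  by rewrite (bigD1 i)//=; lra.
move: sum_le Ha Hb; rewrite sumrB => sum_le.
have ne : e <= n%:R * e by rewrite ler_peMl.
have := ab i; have := ler_norm (t - s); have := normr_ge0 (s - t).
rewrite (distrC t) !ler_norml => ? ? ? /andP[? ?] /andP[? ?].
by apply/andP; split; rewrite -!mulrA; lra.
Qed.

(** * Comonotone improvement on a probability space *)

Section ComonotoneImprovement.
Context {d : measure_display} {T : measurableType d} {R : realType}.
Variables (P : probability T R) (n : nat).

(* The weights P(cell) + e / (#|C| + 1) are bounded away from zero; the second term
   costs at most a multiple of e in the expectations. *)
Lemma approximate_improvement (Y : 'I_n -> T -> R) (M e : R) :
  (forall i, Linf (Y i)) -> (forall i w, `|Y i w| <= M) -> 0 <= M -> 0 < e ->
  exists Z : 'I_n -> T -> R,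
    [/\ forall i, Linf (Z i),
        forall i w, `|Z i w| <= M,
        forall w, `|\sum_i Z i w - \sum_i Y i w| <= n%:R * e,
        forall w w', (forall i, Z i w <= Z i w' + e) \/
                     (forall i, Z i w' <= Z i w + e) &
        forall i (phi : R -> R) (L : R), nondecreasing_concave phi ->
          (forall x y, `|x| <= M -> `|y| <= M -> phi y <= phi x + L * `|y - x|) ->
          0 <= L ->
          \int[P]_w phi (Y i w) <=
            \int[P]_w phi (Z i w) + (L + (phi M - phi (- M))) * e].
Proof.
move=> YL YM M_ge0 e_gt0.
have mY i : measurable_fun setT (Y i) by have [] := YL i.
have [C [cell [y0 [mcell y0M Yy0]]]] := discretize mY YM M_ge0 e_gt0.
pose p c := fine (P (cell @^-1` [set c])).
pose delta := e / #|C|.+1%:R.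
have delta_gt0 : 0 < delta by rewrite divr_gt0.
have p_ge0 c : 0 <= p c by exact: fine_ge0.
have q_ge c : delta <= p c + delta by rewrite lerDr.
have [y [yM ysum yphi] ycom] :=
  @finite_improvement _ _ _ _ _ _ M delta_gt0 e_gt0 q_ge y0 y0M.
exists (fun i w => y i (cell w)); split=> [i|//|w|w w'|i phi L phic phiL L_ge0].
- exact: Linf_cell.
- rewrite ysum -sumrB; apply: le_trans (ler_norm_sum _ _ _) _.
  rewrite mulr_natl -[X in _ *+ X]card_ord -sumr_const.
  by apply: ler_sum => i _; rewrite distrC.
(* The order of the totals on the two cells decides the alternative for all agents at once. *)
- have [le_s|/ltW le_s] := leP (\sum_k y0 k (cell w)) (\sum_k y0 k (cell w')).
    by left=> i; exact: ycom.
  by right=> i; exact: ycom.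
have [phi_homo _] := phic.
have LY := Linf_monotone_bound phi_homo (YL i).
have Ly0 := @Linf_cell _ _ _ _ cell mcell (fun c => phi (y0 i c)).
have H1 : \int[P]_w phi (Y i w) <= \int[P]_w phi (y0 i (cell w)) + L * e.
  apply: Rintegral_le_add => // w.
  apply: le_trans (phiL _ _ (y0M i (cell w)) (YM i w)) _.
  by rewrite lerD2l ler_wpM2l.
apply: le_trans H1 _; rewrite mulrDl addrA addrAC lerD2r.
rewrite (@Rintegral_cell _ _ _ P _ cell mcell (fun c => phi (y0 i c))).
rewrite (@Rintegral_cell _ _ _ P _ cell mcell (fun c => phi (y i c))).
have := yphi i phi phic.
under eq_bigr do rewrite mulrDl; rewrite big_split/=.
under [X in _ <= X]eq_bigr do rewrite mulrDl; rewrite big_split/= -!mulr_sumr => H.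
(* Each summand varies by at most the oscillation of [phi] on the range, and the extra mass over all
   cells is [#|C| * delta <= e]. *)
have osc : \sum_c phi (y i c) - \sum_c phi (y0 i c) <= #|C|%:R * (phi M - phi (- M)).
  rewrite -sumrB mulr_natl -[X in _ *+ X](_ : #|[pred c : C | true]| = _)//.
  rewrite -sumr_const; apply: ler_sum => c _.
  have := yM i c; have := y0M i c; rewrite !ler_norml => /andP[/phi_homo ? _].
  by move=> /andP[_ /phi_homo ?]; lra.
have osc_ge0 : 0 <= phi M - phi (- M).
  by rewrite subr_ge0 phi_homo//; move: M_ge0; lra.
have : delta * (\sum_c phi (y i c) - \sum_c phi (y0 i c)) <= (phi M - phi (- M)) * e.
  apply: le_trans (ler_wpM2l (ltW delta_gt0) osc) _.
  rewrite mulrA mulrC ler_wpM2l// /delta mulrAC ler_pdivrMr// ler_pM2l//.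
  by rewrite ler_nat.
by move: H; rewrite mulrBr; lra.
Qed.

Theorem comonotone_improvement (Y : 'I_n -> T -> R) : (forall i, Linf (Y i)) ->
  exists Z : 'I_n -> T -> R,
    [/\ forall i, Linf (Z i), forall w, \sum_i Z i w = \sum_i Y i w,
        comonotone Z & forall i, icv_le P (Y i) (Z i)].
Proof.
move=> YL.
have [M M_ge0 YM] : exists2 M, 0 <= M & forall i w, `|Y i w| <= M.
  have /choice[m mP] i : exists m, forall w, `|Y i w| <= m by have [_ ?] := YL i.
  exists (\sum_i `|m i|); first exact: sumr_ge0.
  move=> i w; rewrite (le_trans (mP i w))// (bigD1 i)//= (le_trans (ler_norm _))//.
  by rewrite lerDl sumr_ge0.
have [S_ SE] : exists S_ : T -> R, S_ = fun w => \sum_i Y i w by eexists.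
pose eps m : R := m.+1%:R^-1.
have eps_gt0 m : 0 < eps m by rewrite invr_gt0.
have /choice[Z_ Z_P] m := approximate_improvement YL YM M_ge0 (eps_gt0 m).
(* An ultrafilter gives limits at all states at once, where a diagonal subsequence would serve only
   countably many. *)
have [F [FU ooF]] := @ultraFilterLemma _ (\oo : set_system nat) _.
have FP : ProperFilter F by exact: (@ultra_proper _ F FU).
have Feps e : 0 < e -> F [set m | eps m <= e].
  move=> e_gt0; apply: ooF.
  have := near_infty_natSinv_lt (PosNum e_gt0).
  by apply: filterS => m /= /ltW.
have /choice[Zf ZfP] (iw : 'I_n * T) : exists l, forall e, 0 < e ->
    F [set m | `|Z_ m iw.1 iw.2 - l| <= e].
  by apply: (@ultra_bounded_limit _ _ _ M) => m; have [_ ZM _ _ _] := Z_P m.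
pose Z i w := Zf (i, w).
have ZP w e : 0 < e -> F [set m | forall i, `|Z_ m i w - Z i w| <= e].
  by move=> e_gt0; apply: filter_forall => i; exact: (ZfP (i, w)).
have Zsum w : \sum_i Z i w = S_ w.
  apply/eqP; rewrite -subr_eq0 -normr_le0.
  apply: (@le_of_forall_eps _ _ _ (2 * n%:R)) => e e_gt0.
  have [m [/= me mZ]] := filter_ex (filterI (Feps e e_gt0) (ZP w e e_gt0)).
  have [_ _ /(_ w) Zm _ _] := Z_P m.
  rewrite add0r -mulrA mulr_natl mulr2n.
  apply: le_trans (ler_distD (\sum_i Z_ m i w) _ _) (lerD _ _).
    rewrite -sumrB; apply: le_trans (ler_norm_sum _ _ _) _.
    rewrite mulr_natl -[X in _ *+ X]card_ord -sumr_const.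
    by apply: ler_sum => i _; rewrite distrC.
  by rewrite SE; apply: le_trans Zm _; rewrite ler_wpM2l.
have ZM i w : `|Z i w| <= M.
  apply: (@le_of_forall_eps _ _ _ 1) => e e_gt0.
  have [m /= mZ] := filter_ex (ZP w e e_gt0).
  have [_ /(_ i w) Zm _ _ _] := Z_P m.
  have := ler_distD (Z_ m i w) (Z i w) 0; rewrite !subr0 distrC mul1r.
  by have := mZ i; lra.
have Zmono w w' : (forall i, Z i w <= Z i w') \/ (forall i, Z i w' <= Z i w).
  have le_lim v v' : F [set m | forall i, Z_ m i v <= Z_ m i v' + eps m] ->
      forall i, Z i v <= Z i v'.
    move=> Fle i; apply: (@le_of_forall_eps _ _ _ 3) => e e_gt0.
    have [m [[/= mle me] [mv mv']]] := filter_ex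
      (filterI (filterI Fle (Feps e e_gt0)) (filterI (ZP v e e_gt0) (ZP v' e e_gt0))).
    have := mle i; have := mv i; have := mv' i; rewrite !ler_norml.
    by move: me => /= me /andP[? ?] /andP[? ?] ?; lra.
  (* One of the two orderings holds along [F] and therefore passes to the limit. *)
  have [Fle|Fnle] :=
    in_ultra_setVsetC [set m | forall i, Z_ m i w <= Z_ m i w' + eps m] FU.
    by left; exact: le_lim.
  right; apply: le_lim; apply: filterS Fnle => m /= nle.
  by have [_ _ _ /(_ w w')[]] := Z_P m.
(* With tolerance zero, each limit share is exactly 1-Lipschitz in the total. *)
have Zlip i w w' : `|Z i w - Z i w'| <= `|S_ w - S_ w'|.
  have := @almost_comonotone_lipschitz _ _ (Z^~ w) (Z^~ w') (S_ w) (S_ w') 0 (lexx _).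
  rewrite !Zsum !subrr normr0 !mulr0 addr0 => /(_ (lexx _) (lexx _)) H; apply: H.
  by have [H|H] := Zmono w w'; [left|right] => k; rewrite addr0.
(* Finitely many cells on which the total varies by at most [2 * e] suffice, with convergence at one
   state [w0] per cell. The factor collects [2 + 3 * n] for [Z_ m], one for the convergence at [w0]
   and two for [Z]. *)
have Zunif e : 0 < e ->
    F [set m | forall w i, `|Z_ m i w - Z i w| <= (5 + 3 * n%:R) * e].
  move=> e_gt0.
  have SL : Linf S_ by rewrite SE; exact: Linf_sum.
  have [mS [N SN]] := SL.
  have N_ge0 : 0 <= `|N| by [].
  have [C [cell [s0 [_ _ Ss0]]]] := @discretize _ _ _ 1 (fun=> S_) `|N| e
    (fun=> mS) (fun _ w => le_trans (SN w) (ler_norm N)) N_ge0 e_gt0.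
  have : F [set m | forall c w, cell w = c ->
      forall i, `|Z_ m i w - Z i w| <= (5 + 3 * n%:R) * e].
    apply: filter_forall => c.
    have [[w0 w0c]|noc] := pselect (exists w0, cell w0 = c); last first.
      by apply: filterE => m w wc; exfalso; apply: noc; exists w.
    apply: filterS (filterI (Feps e e_gt0) (ZP w0 e e_gt0)) => m [/= me mZ] w wc i.
    have Sw : `|S_ w - S_ w0| <= 2 * e.
      have := Ss0 ord0 w; have := Ss0 ord0 w0; rewrite wc w0c !ler_norml.
      by move=> /andP[? ?] /andP[? ?]; apply/andP; split; lra.
    have [_ _ Zmsum Zmcom _] := Z_P m.
    have {}Zmsum v : `|\sum_i Z_ m i v - S_ v| <= n%:R * eps m by rewrite SE.
    have := @almost_comonotone_lipschitz _ _ (Z_ m ^~ w) (Z_ m ^~ w0) (S_ w) (S_ w0)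
      (eps m) (ltW (eps_gt0 m)).
    move=> /(_ (Zmsum w) (Zmsum w0) (Zmcom w w0) i) H1.
    have := Zlip i w0 w; have := mZ i; rewrite distrC (distrC (S_ w0)).
    have : 3 * n%:R * eps m <= 3 * n%:R * e by rewrite ler_wpM2l// mulr_ge0.
    move: H1 Sw; rewrite mulrDl.
    have := ler_distD (Z_ m i w0) (Z_ m i w) (Z i w).
    have := ler_distD (Z i w0) (Z_ m i w0) (Z i w).
    rewrite (distrC (Z i w0) (Z_ m i w0)); lra.
  by apply: filterS => m /= H w i; exact: H.
have ZL i : Linf (Z i).
  split; last by exists M.
  (* Measurability needs a sequential limit: uniform convergence along [F] allows picking indices
     [mk k] with errors tending to zero. *)
  have /choice[mk mkP] (k : nat) : exists m, forall w i,
      `|Z_ m i w - Z i w| <= (5 + 3 * n%:R) * eps k.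
    by have [m mP] := filter_ex (Zunif _ (eps_gt0 k)); exists m.
  apply: (@measurable_fun_cvg _ _ _ _ (fun k => Z_ (mk k) i)) => [k|w _].
    by have [/(_ i)[]] := Z_P (mk k).
  apply/cvgrPdist_le => e e_gt0.
  have K_gt0 : 0 < 5 + 3 * n%:R :> R by rewrite ltr_wpDr// mulr_ge0.
  have := near_infty_natSinv_lt (PosNum (divr_gt0 e_gt0 K_gt0)).
  apply: filterS => k /= /ltW; rewrite ler_pdivlMr// mulrC => ke.
  by rewrite distrC; exact: le_trans (mkP k w i) ke.
exists Z; split=> //.
- by move=> w; rewrite Zsum SE.
- move=> w w' i j; have [H|H] := Zmono w w'.
    by rewrite mulr_le0// subr_le0.
  by rewrite mulr_ge0// subr_ge0.
move=> i phi phi_homo phi_conc.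
have phic : nondecreasing_concave phi by [].
have [L L_ge0 phiL] := concave_lipschitz M phic.
have YLp := Linf_monotone_bound phi_homo (YL i).
have ZLp := Linf_monotone_bound phi_homo (ZL i).
rewrite -[leLHS]fineK; last exact: integrable_fin_num (Linf_integrable P YLp).
rewrite -[leRHS]fineK; last exact: integrable_fin_num (Linf_integrable P ZLp).
rewrite lee_fin -/(Rintegral _ _ _) -/(Rintegral _ _ _).
(* The first part of the factor comes from the approximate improvement, the last term from replacing
   [Z_ m] by [Z]. *)
apply: (@le_of_forall_eps _ _ _ (L + (phi M - phi (- M)) + L * (5 + 3 * n%:R))).
move=> e e_gt0.
have [m [/= me mZ]] := filter_ex (filterI (Feps e e_gt0) (Zunif e e_gt0)).
have [/(_ i) Z_L /(_ i) Z_M _ _ /(_ i phi L phic phiL L_ge0) H] := Z_P m.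
have Z_Lp := Linf_monotone_bound phi_homo Z_L.
have : \int[P]_w phi (Z_ m i w) <= \int[P]_w phi (Z i w) + L * ((5 + 3 * n%:R) * e).
  apply: Rintegral_le_add => // w.
  apply: le_trans (phiL _ _ (ZM i w) (Z_M w)) _.
  by rewrite lerD2l ler_wpM2l.
have : (L + (phi M - phi (- M))) * eps m <= (L + (phi M - phi (- M))) * e.
  rewrite ler_wpM2l// addr_ge0// subr_ge0 phi_homo//; move: M_ge0; lra.
move: H; rewrite [X in _ -> _ -> _ -> _ <= _ + X]mulrDl -[L * _ * e]mulrA; lra.
Qed.

End ComonotoneImprovement.

(** * Pareto optima and weighted suprema *)

Theorem mainTheorem4 (d : measure_display) (T : measurableType d) (R : realType)
  (P : probability T R) (n : nat) (X : 'I_n -> T -> R) (U : 'I_n -> (T -> R) -> R) :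
  atomless P ->
  (1 < n)%N ->
  (forall i, Linf (X i)) ->
  (forall i, concave_util (U i)) ->
  (forall i, ssd_preserving P (U i)) ->
  (forall i Z, Linf Z -> continuous (fun c : R => U i (fun w => Z w + c))) ->
  (forall i Z, Linf Z -> forall c1 c2 : R, c1 < c2 ->
       U i (fun w => Z w + c1) < U i (fun w => Z w + c2)) ->
  (forall i Z, Linf Z -> U i (fun w => Z w + c) @[c --> +oo] --> +oo) ->
  ((exists Y, pareto_opt U X Y) <-> (exists Y, comonotone_pareto_opt U X Y)) /\
  ((exists Y, pareto_opt U X Y) -> (exists Y, comonotone_pareto_opt U X Y) ->
   forall lam : 'I_n -> R, (forall i, 0 <= lam i) -> (exists i, lam i != 0) ->
     weighted_sup U X lam (fun _ => True) = weighted_sup U X lam (fun Y => comonotone Y)).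
Proof.
move=> _ _ _ _ Ussd _ _ _.
(* S.S.D. preservation turns dominance into weakly higher utilities, so individual rationality
   survives. *)
have improve Y : indiv_rational U X Y -> exists Z,
    [/\ comonotone Z, indiv_rational U X Z & forall i, U i (Y i) <= U i (Z i)].
  move=> [[YL Ysum] YIR]; have [Z [ZL Zsum Zcom YZ]] := comonotone_improvement P YL.
  have UYZ i : U i (Y i) <= U i (Z i) by exact: Ussd.
  exists Z; split=> //; split; last by move=> i; exact: le_trans (YIR i) (UYZ i).
  by split=> // w; rewrite Zsum.
split; last first.
  (* Nonnegative weights carry the improvement over to the weighted sums; the other inequality is
     inclusion. *)
  move=> _ _ lam lam_ge0 _; apply/eqP; rewrite eq_le; apply/andP; split.
    apply: ge_ereal_sup => _ [Y [YIR _] <-].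
    have [Z [Zcom ZIR YZ]] := improve Y YIR.
    apply: (@le_trans _ _ (\sum_(i < n) lam i * U i (Z i))%:E).
      by rewrite lee_fin; apply: ler_sum => i _; rewrite ler_wpM2l.
    by apply: ereal_sup_ubound; exists Z.
  by apply: ereal_sup_le => _ [Y [YIR _] <-]; exists Y.
split=> [[Y [YIR Yopt]]|[Y [Ycom [YIR Yopt]]]].
  (* Whatever beats the improvement [Z] of a Pareto optimum [Y] would also beat [Y]. *)
  have [Z [Zcom ZIR YZ]] := improve Y YIR.
  exists Z; split=> //; split=> // -[W [_ [WIR [ZW [i ZWi]]]]].
  apply: Yopt; exists W; split=> //; split; first by move=> k; exact: le_trans (ZW k).
  by exists i; exact: le_lt_trans (YZ i) ZWi.
(* A comonotone optimum is itself Pareto optimal: if some [W] beats it, so does the comonotone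
   improvement of [W]. *)
exists Y; split=> // -[W [WIR [YW [i YWi]]]].
have [Z [Zcom ZIR WZ]] := improve W WIR.
apply: Yopt; exists Z; do 3 split=> //; first by move=> k; exact: le_trans (YW k) (WZ k).
by exists i; exact: lt_le_trans YWi (WZ i).
Qed.
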